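(* Let $p\in[1,\infty]$, and let $\{E_i\}_{i\in I}$ be a non-empty family of locally convex spaces. Then: (i) a subset $K$ of $E=\prod_{i\in I} E_i$ is a coarse $p$-limited set if and only if so are all its coordinate projections; (ii) a subset $K$ of $E=\bigoplus_{i\in I} E_i$ is a coarse $p$-limited set if and only if so are all its coordinate projections and the support of $K$ is finite.
   Context: All locally convex spaces are Hausdorff, over $\mathbb{F}\in\{\mathbb{R},\mathbb{C}\}$; subsets are non-empty. $\prod_{i\in I}E_i$ carries the product topology and $\bigoplus_{i\in I}E_i$ is the locally convex direct sum. For $x=(x_i)\in\bigoplus_{i\in I}E_i$, $\mathrm{supp}(x)=\{i\in I:x_i\neq0\}$, and the support of a subset $K$ is $\bigcup_{x\in K}\mathrm{supp}(x)$. The coordinate projections of $K$ are the images of $K$ under the canonical projections $E\to E_i$. A non-empty subset $A$ of an lcs $E$ is coarse $p$-limited if $T(A)$ is relatively compact for every continuous linear map $T:E\to\ell_p$ (or $T:E\to c_0$ if $p=\infty$). *)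

(* Defs.v *)
From HB Require Import structures.
From mathcomp Require Import all_boot all_order all_algebra.
From mathcomp Require Import complex.
From mathcomp Require Import all_classical all_reals all_analysis.

Set Implicit Arguments.
Unset Strict Implicit.
Unset Printing Implicit Defensive.
Import Order.TTheory GRing.Theory Num.Theory.
Import numFieldNormedType.Exports.
Local Open Scope classical_set_scope.
Local Open Scope ring_scope.

(* [prod_topology E] is the dependent product with the product topology of the
   library; here it is made a locally convex space. *)
Section product.
Context {K : numFieldType} {I : Type} (E : I -> tvsType K).
Local Notation PE := (prod_topology E).

Let padd (x y : PE) : PE := fun i => x i + y i.
Let popp (x : PE) : PE := fun i => - x i.
Let pzero : PE := fun i => 0.
Let pscale (k : K) (x : PE) : PE := fun i => k *: x i.

Let paddA : associative padd.
Proof. by move=> x y z; apply/functional_extensionality_dep => i; exact: addrA. Qed.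
Let paddC : commutative padd.
Proof. by move=> x y; apply/functional_extensionality_dep => i; exact: addrC. Qed.
Let padd0 : left_id pzero padd.
Proof. by move=> x; apply/functional_extensionality_dep => i; exact: add0r. Qed.
Let paddN : left_inverse pzero popp padd.
Proof. by move=> x; apply/functional_extensionality_dep => i; exact: addNr. Qed.

HB.instance Definition _ :=
  GRing.isZmodule.Build PE paddA paddC padd0 paddN.

Let pscaleA a b x : pscale a (pscale b x) = pscale (a * b) x.
Proof. by apply/functional_extensionality_dep => i; exact: scalerA. Qed.
Let pscale1 : left_id 1 pscale.
Proof. by move=> x; apply/functional_extensionality_dep => i; exact: scale1r. Qed.
Let pscaleDr : right_distributive pscale +%R.
Proof. by move=> a x y; apply/functional_extensionality_dep => i; exact: scalerDr. Qed.
Let pscaleDl x : {morph pscale^~ x : a b / a + b}.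
Proof. by move=> a b; apply/functional_extensionality_dep => i; exact: scalerDl. Qed.

HB.instance Definition _ :=
  GRing.Zmodule_isLmodule.Build K PE pscaleA pscale1 pscaleDr pscaleDl.

Lemma prod_topologyD (x y : PE) i : (x + y) i = x i + y i.
Proof. by []. Qed.

Lemma prod_topologyZ (k : K) (x : PE) i : (k *: x) i = k *: x i.
Proof. by []. Qed.

Lemma prod_topology_cvg (F : set_system PE) (x : PE) : Filter F ->
  (forall i, (fun y : PE => y i) @ F --> x i) -> F --> x.
Proof.
move=> FF h; apply/cvg_sup => i A /=.
rewrite /nbhs/= => -[_ [[B oB <-] Bx] sBA].
apply: (filterS sBA); apply: (h i B).
exact: open_nbhs_nbhs.
Qed.

Lemma prod_topology_proj i : continuous (fun x : PE => x i).
Proof. exact: (@proj_continuous {classic I}). Qed.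


Let pDc : continuous (fun x : PE * PE => x.1 + x.2).
Proof.
move=> z; apply: prod_topology_cvg => i.
have H : (fun x : PE * PE => (x.1 i, x.2 i)) @ z --> (z.1 i, z.2 i).
  apply: cvg_pair => /=.
    apply: (cvg_comp fst (fun y : PE => y i)); last exact: prod_topology_proj.
    exact: cvg_fst.
  apply: (cvg_comp snd (fun y : PE => y i)); last exact: prod_topology_proj.
  exact: cvg_snd.
exact: (cvg_comp _ _ H (@add_continuous (E i) (z.1 i, z.2 i))).
Qed.

Let pZc : continuous (fun z : K^o * PE => z.1 *: z.2).
Proof.
move=> z; apply: prod_topology_cvg => i.
have H : (fun x : K^o * PE => (x.1 : K^o, x.2 i)) @ z --> ((z.1, z.2 i) : K^o * E i).
  apply: (@cvg_pair _ _ _ _ (nbhs (z.1 : K^o))); first exact: cvg_fst.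
  apply: (cvg_comp snd (fun y : PE => y i)); last exact: prod_topology_proj.
  exact: cvg_snd.
exact: (cvg_comp _ _ H (@scale_continuous K (E i) (z.1, z.2 i))).
Qed.

Let plc : exists2 B : set_system PE,
  (forall b, b \in B -> convex_set b) & basis B.
Proof.
exists [set U | open U /\ convex_set U]; first by move=> b /[!inE] -[].
split; first by move=> b [].
move=> x A /=.
rewrite /nbhs/= => -[_ [[B sB <-] [C BC Cx] sBA]].
have [D sD IDC] := sB _ BC.
suff: filter_from [set U | (open U /\ convex_set U) /\ U x] id C.
  case=> U xU UC; exists U => //; apply: subset_trans UC _.
  by apply: subset_trans sBA => y Cy; exists C.
rewrite -IDC.
have FF : Filter (filter_from [set U : set PE | (open U /\ convex_set U) /\ U x] id).
  apply: filter_from_filter.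
    exists setT; split => //; split; first exact: openT.
    by move=> ? ? ? _ _; rewrite inE.
  move=> U V [[oU cU] Ux] [[oV cV] Vx]; exists (U `&` V) => //.
  split=> //; split; first exact: openI.
  move=> a b l; rewrite !in_setI => /andP[Ua Va] /andP[Ub Vb].
  by rewrite cU// cV.
apply: filter_bigI => V DV.
have Vx : V x by move: Cx; rewrite -IDC; apply.
have := sD _ DV; rewrite inE => -[i _] [W oW WV].
have [Bi cBi [oBi bBi]] := @locally_convex K (E i).
have [W' [BW' W'x] W'W] : filter_from [set U | Bi U /\ U (x i)] id W.
  by apply: bBi; apply: open_nbhs_nbhs; split => //; move: Vx; rewrite -WV.
exists ((fun y : PE => y i) @^-1` W'); last by rewrite -WV => y /W'W.
split=> //; split.
  by apply: open_comp => [? _|]; [exact: prod_topology_proj|exact: oBi].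
move=> a b l /[!inE] /mem_set Wa /mem_set Wb; apply: set_mem.
by apply: cBi => //; exact: mem_set.
Qed.

HB.instance Definition _ :=
  PreTopologicalNmodule_isTopologicalNmodule.Build PE pDc.
HB.instance Definition _ :=
  TopologicalNmodule_isTopologicalLmodule.Build K PE pZc.
HB.instance Definition _ := Uniform_isTvs.Build K PE plc.

End product.

Definition abs_convex (K : numFieldType) (V : lmodType K) (U : set V) :=
  U 0 /\ forall (a b : K) (x y : V),
    U x -> U y -> `|a| + `|b| <= 1 -> U (a *: x + b *: y).

Section direct_sum.
Context {K : numFieldType} {I : Type} (E : I -> tvsType K).
Local Notation PE := (prod_topology E).

Definition supp (x : forall i, E i) : set I := [set i | x i != 0].

Definition finite_supp : {pred PE} :=
  fun x : PE => `[< finite_set (supp x) >].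

Record dsum := DSum { dsum_val : PE; _ : dsum_val \in finite_supp }.

HB.instance Definition _ := [isSub for dsum_val].
HB.instance Definition _ := [Choice of dsum by <:].

Let finite_supp_submod : submod_closed finite_supp.
Proof.
split.
  apply/asboolP; rewrite (_ : supp _ = set0)//.
  by apply/seteqP; split=> // i /= /eqP; exact.
move=> a x y /asboolP fx /asboolP fy; apply/asboolP.
apply: (@sub_finite_set _ _ (supp x `|` supp y)); last by rewrite finite_setU.
move=> i; rewrite /supp/= prod_topologyD prod_topologyZ => axy.
have [xi0|] := eqVneq (x i) 0; last by left.
by right; apply: contra_neq axy => yi0; rewrite xi0 yi0 scaler0 addr0.
Qed.

HB.instance Definition _ :=
  GRing.isSubmodClosed.Build K PE finite_supp finite_supp_submod.
HB.instance Definition _ := [SubChoice_isSubLmodule of dsum by <:].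

Definition dsum_fun (x : dsum) : forall i, E i := dsum_val x.
Coercion dsum_fun : dsum >-> Funclass.

Lemma dsumP (x y : dsum) : (forall i, x i = y i) -> x = y.
Proof. by move=> xy; apply: val_inj; exact: functional_extensionality_dep. Qed.

Lemma dsumD (x y : dsum) i : (x + y) i = x i + y i.
Proof. by []. Qed.

Lemma dsumZ (k : K) (x : dsum) i : (k *: x) i = k *: x i.
Proof. by []. Qed.

Lemma dsum0 i : (0 : dsum) i = 0. Proof. by []. Qed.

(* [dfwith] needs decidable equality on the index type, hence [{classic I}]. *)
Definition single (i : I) (a : E i) : PE :=
  @dfwith {classic I} E (fun=> 0) i a.

Lemma single_subproof i (a : E i) : single a \in finite_supp.
Proof.
apply/asboolP; apply: (@sub_finite_set _ _ [set i]); last exact: finite_set1.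
move=> j; rewrite /supp/= /single; have [->|ji] := pselect (j = i); first by [].
by rewrite (@dfwithout {classic I})//; [move=> /eqP | apply/eqP => ij; exact: ji].
Qed.

Definition dsum_inj (i : I) (a : E i) : dsum := DSum (single_subproof a).

Lemma dsum_inj_in i (a : E i) : dsum_inj a i = a.
Proof. exact: (@dfwithin {classic I}). Qed.

Lemma dsum_inj_out i (a : E i) j : i <> j -> dsum_inj a j = 0.
Proof. by move=> ij; apply: (@dfwithout {classic I}); exact/eqP. Qed.

Lemma dsum_injP i : linear (@dsum_inj i).
Proof.
move=> k a b; apply: dsumP => j; rewrite dsumD dsumZ.
have [ij|ij] := pselect (i = j); last by rewrite !dsum_inj_out// scaler0 addr0.
by subst j; rewrite !dsum_inj_in.
Qed.

HB.instance Definition _ i :=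
  GRing.isLinear.Build K (E i) dsum *:%R (@dsum_inj i) (@dsum_injP i).

(* These sets form a base of neighborhoods of [0] for the finest locally convex
   topology making all the injections continuous, see [dsum_inj_continuous] and
   [dsum_linear_continuous]. *)
Definition dsum_base (U : set dsum) :=
  abs_convex U /\ forall i, nbhs (0 : E i) (@dsum_inj i @^-1` U).

Definition dsum_nbhs (x : dsum) : set_system dsum :=
  filter_from dsum_base (fun U => [set x + u | u in U]).

Let dsum_nbhsE x V : dsum_nbhs x V <->
  exists2 U, dsum_base U & forall u, U u -> V (x + u).
Proof.
split=> -[U bU UV]; exists U => //.
  by move=> u Uu; apply: UV; exists u.
by move=> _ [u Uu <-]; exact: UV.
Qed.

Let baseT : dsum_base setT.
Proof. by split; [split | move=> i; exact: filterT]. Qed.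

Let baseI U V : dsum_base U -> dsum_base V -> dsum_base (U `&` V).
Proof.
move=> [[U0 cU] nU] [[V0 cV] nV]; split; last by move=> i; exact: filterI.
split=> // a b x y [Ux Vx] [Uy Vy] ab.
by split; [exact: cU|exact: cV].
Qed.

Let baseZ k U : k != 0 -> dsum_base U -> dsum_base [set x | U (k *: x)].
Proof.
move=> k0 [[U0 cU] nU]; split.
  split=> /=; first by rewrite scaler0.
  move=> a b x y Ux Uy ab; rewrite scalerDr !scalerA mulrC (mulrC k b).
  by rewrite -!scalerA; exact: cU.
move=> i.
have := nbhs0Z (invr_neq0 k0) (nU i); apply: filterS => _ [a Ua <-] /=.
by rewrite linearZ/= scalerA divff// scale1r.
Qed.

Let base_half U : dsum_base U -> exists2 W, dsum_base W &
  forall x y, W x -> W y -> U (x + y).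
Proof.
move=> bU; exists [set x | U (2 *: x)]; first exact: baseZ.
move=> x y /= Ux Uy; case: bU => -[_ cU] _.
have := cU 2^-1 2^-1 _ _ Ux Uy; rewrite !scalerA mulVf// !scale1r; apply.
by rewrite ger0_norm ?invr_ge0// -mulr2n -[X in X *+ _]mul1r -mulrnAr -mulr_natl mulfV.
Qed.

Let base_le U (a : K) x : dsum_base U -> U x -> `|a| <= 1 -> U (a *: x).
Proof.
move=> [[U0 cU] _] Ux a1; have := cU a 0 x 0 Ux U0.
by rewrite scale0r addr0 normr0 addr0; exact.
Qed.

Let dsum_nbhs_filter x : ProperFilter (dsum_nbhs x).
Proof.
apply: filter_from_proper; last first.
  by move=> U [[U0 _] _]; exists (x + 0); exists 0.
apply: filter_from_filter; first by exists setT.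
move=> U V bU bV; exists (U `&` V); first exact: baseI.
by move=> _ [u [Uu Vu] <-]; split; exists u.
Qed.

Let dsum_nbhs_singleton x A : dsum_nbhs x A -> A x.
Proof.
by move=> /dsum_nbhsE[U [[U0 _] _] /(_ _ U0)]; rewrite addr0.
Qed.

Let dsum_nbhs_nbhs x A : dsum_nbhs x A -> dsum_nbhs x (dsum_nbhs^~ A).
Proof.
move=> /dsum_nbhsE[U bU UA]; have [W bW WU] := base_half bU.
apply/dsum_nbhsE; exists W => // u Wu; apply/dsum_nbhsE; exists W => // v Wv.
by rewrite -addrA; apply: UA; exact: WU.
Qed.

HB.instance Definition _ := hasNbhs.Build dsum dsum_nbhs.
HB.instance Definition _ := Nbhs_isNbhsTopological.Build dsum
  dsum_nbhs_filter dsum_nbhs_singleton dsum_nbhs_nbhs.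

Let dsum_nbhsP (x : dsum) V : nbhs x V <->
  exists2 U, dsum_base U & forall u, U u -> V (x + u).
Proof. exact: dsum_nbhsE. Qed.

Let dsum_add_continuous : continuous (fun x : dsum * dsum => x.1 + x.2).
Proof.
move=> [x y] A /= /dsum_nbhsP[U bU UA]; have [W bW WU] := base_half bU.
exists ([set x + w | w in W], [set y + w | w in W]) => /=.
  by split; apply/dsum_nbhsP; exists W => // u Wu; exists u.
move=> [_ _] [/= [u Wu <-] [v Wv <-]] /=.
by rewrite addrACA; apply: UA; exact: WU.
Qed.

Let base_absorb U x : dsum_base U ->
  \forall m \near (0 : K^o), U (m *: x).
Proof.
have [s sx] : exists s : seq {classic I}, forall i, x i != 0 -> i \in s.
  case: x => x /= /asboolP/(@finite_seqP {classic I})[s sE].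
  exists s => i xi; have : supp x i by [].
  by rewrite sE.
elim: s x sx U => [|i s IH] x sx U bU.
  apply: (@filterE _ (nbhs (0 : K^o))) => m; rewrite (_ : x = 0).
    by rewrite scaler0; case: bU => -[].
  by apply: dsumP => i; apply/eqP/negPn/negP => /sx.
have [W bW WU] := base_half bU.
pose y := x - dsum_inj (x i).
have yE j : y j = x j - dsum_inj (x i) j by [].
have ys j : y j != 0 -> j \in s.
  rewrite yE; have [ij|ij] := pselect (i = j).
    by subst j; rewrite dsum_inj_in subrr eqxx.
  rewrite dsum_inj_out// subr0 => /sx/predU1P[ji|//].
  by case: ij.
have Wy := IH y ys W bW.
have Wx : \forall m \near (0 : K^o), W (m *: dsum_inj (x i)).
  have := @scale_continuous K (E i) (0, x i) (@dsum_inj i @^-1` W).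
  rewrite /= scale0r => /(_ (bW.2 i)) [[A B] [/= A0 Bx] AB].
  apply: filterS A0 => m Am; rewrite -linearZ; apply: (AB (m, x i)).
  by split=> //; exact: nbhs_singleton.
apply: (@filterS2 _ (nbhs (0 : K^o)) _ _ _ _ _ Wx Wy) => m {}Wx {}Wy.
rewrite (_ : x = dsum_inj (x i) + y); last by rewrite addrC subrK.
by rewrite scalerDr; exact: WU.
Qed.

Let dsum_scale_continuous : continuous (fun z : K^o * dsum => z.1 *: z.2).
Proof.
move=> [k x] A /= /dsum_nbhsP[U bU UA]; have [W bW WU] := base_half bU.
have M0 : 0 < `|k| + 1 :> K by rewrite ltr_wpDl.
pose V := [set u | W ((`|k| + 1) *: u)].
have bV : dsum_base V by apply: baseZ => //; rewrite gt_eqF.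
exists (ball (k : K^o) 1 `&` [set l | W ((l - k) *: x)],
        [set x + u | u in V]) => /=.
  split; last by apply/dsum_nbhsP; exists V => // u Vu; exists u.
  apply: filterI; first exact: nbhsx_ballx.
  have /nbhs_ballP[e /= e0 eW] := base_absorb x bW.
  apply/nbhs_ballP; exists e => //= l kl; apply: eW.
  by move: kl; rewrite -!ball_normE /= opprB add0r distrC.
move=> [l _] [/= [kl Wl] [u Vu <-]] /=.
rewrite (_ : l *: _ = k *: x + ((l - k) *: x + l *: u)); last first.
  by rewrite addrA -scalerDl [k + _]addrC subrK scalerDr.
apply: UA; apply: WU => //.
have -> : l *: u = (l / (`|k| + 1)) *: ((`|k| + 1) *: u).
  by rewrite scalerA divfK// gt_eqF.
apply: base_le => //; rewrite normrM normfV (gtr0_norm M0) ler_pdivrMr// mul1r.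
rewrite -[l](subrK k) addrC (le_trans (ler_normD _ _))// lerD2l ltW//.
by move: kl; rewrite -ball_normE /= distrC.
Qed.

Let dsum_locally_convex : exists2 B : set_system dsum,
  (forall b, b \in B -> convex_set b) & basis B.
Proof.
exists [set U | open U /\ convex_set U]; first by move=> b /[!inE] -[].
split; first by move=> b [].
move=> x A /dsum_nbhsP[U bU UA].
pose O : set dsum := [set y | U (y - x)].
have xO : nbhs x O.
  by apply/dsum_nbhsP; exists U => // u Uu; rewrite /O/= addrC addKr.
exists O^°; last first.
  move=> y /interior_subset Oy.
  by rewrite -(subrK x y) addrC; exact: UA.
split; last exact: xO.
split; first exact: open_interior.
move=> y z t /[!inE] /dsum_nbhsP[V bV VO] /dsum_nbhsP[W bW WO].
apply/dsum_nbhsP; exists (V `&` W); first exact: baseI.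
move=> u [/VO Oyu /WO Ozu].
have t0 : 0 <= t%:num by [].
have t1 : 0 <= 1 - t%:num :> K by rewrite subr_ge0.
have := bU.1.2 t%:num (1 - t%:num) _ _ Oyu Ozu.
rewrite !ger0_norm// [X in X <= 1]addrC subrK => /(_ (lexx _)); congr U.
have lin (v w h : dsum) (c : K) :
    c *: (v + h) + (1 - c) *: (w + h) = c *: v + (1 - c) *: w + h.
  by rewrite !scalerDr addrACA -scalerDl addrCA subrr addr0 scale1r.
have := lin (y : dsum) (z : dsum) (u - x) t%:num.
by rewrite !addrA.
Qed.

HB.instance Definition _ := PreTopologicalLmod_isTvs.Build K dsum
  dsum_add_continuous dsum_scale_continuous dsum_locally_convex.
HB.instance Definition _ :=
  PreTopologicalNmodule_isTopologicalNmodule.Build dsum dsum_add_continuous.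
HB.instance Definition _ :=
  TopologicalNmodule_isTopologicalLmodule.Build K dsum dsum_scale_continuous.
HB.instance Definition _ := Uniform_isTvs.Build K dsum dsum_locally_convex.

End direct_sum.

Section direct_sum_universal.
Context {K : numFieldType} {I : Type} (E : I -> tvsType K).

Lemma nbhs_dsumP (x : dsum E) V : nbhs x V <->
  exists2 U, dsum_base U & forall u, U u -> V (x + u).
Proof.
split=> -[U bU UV]; exists U => //.
  by move=> u Uu; apply: UV; exists u.
by move=> _ [u Uu <-]; exact: UV.
Qed.

Lemma dsum_inj_continuous i : continuous (@dsum_inj K I E i).
Proof.
move=> a A /nbhs_dsumP[U [_ nU] UA].
have := nbhsT a (nU i); apply: filterS => _ [b Ub <-] /=.
by rewrite raddfD; exact: UA.
Qed.

Lemma convex_comb (G : tvsType K) (C : set G) (t : K) (x y : G) :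
  convex_set C -> 0 <= t <= 1 -> C x -> C y -> C (t *: x + (1 - t) *: y).
Proof.
move=> cC /andP[t0 t1] Cx Cy.
by have := cC x y (Itv01 t0 t1) (mem_set Cx) (mem_set Cy); rewrite inE.
Qed.

Lemma nbhs0_abs_convex (G : tvsType K) (V : set G) : nbhs 0 V ->
  exists U, [/\ abs_convex U, nbhs 0 U & U `<=` V].
Proof.
move=> V0; have [B cB [oB bB]] := @locally_convex K G.
have [C [BC C0] CV] : filter_from [set U | B U /\ U 0] id V by exact: bB.
have nC : nbhs 0 C by apply: open_nbhs_nbhs; split => //; exact: oB.
have {}cB := cB _ (mem_set BC).
pose U := [set x | forall a : K, `|a| <= 1 -> C (a *: x)].
have UC : U `<=` C by move=> x /(_ 1); rewrite normr1 scale1r; exact.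
have Ubal a x : U x -> `|a| <= 1 -> U (a *: x).
  move=> Ux a1 b b1; rewrite scalerA; apply: Ux.
  by rewrite normrM mulr_ile1.
exists U; split; last exact: subset_trans CV.
- split; first by move=> a _; rewrite scaler0.
  move=> a b x y Ux Uy ab c c1.
  pose s : K := `|a| + `|b|.
  have [s0|s0] := eqVneq s 0.
    have /andP[/eqP a0 /eqP b0] : (`|a| == 0) && (`|b| == 0).
      by rewrite -paddr_eq0// -/s s0.
    by rewrite (normr0_eq0 a0) (normr0_eq0 b0) !scale0r addr0 scaler0.
  have sp : 0 < s by rewrite lt_def s0 addr_ge0.
  have aE (d : K) : d = `|d| * (d / `|d|).
    have [->|d0] := eqVneq d 0; first by rewrite mul0r mulr0.
    by rewrite mulrC divfK// normr_eq0.
  have nE (d : K) : `|d / `|d| | <= 1.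
    have [->|d0] := eqVneq d 0; first by rewrite mul0r normr0 ler01.
    by rewrite normrM normfV normr_id divff// normr_eq0.
  have -> : c *: (a *: x + b *: y) =
      (`|a| / s) *: ((c * s * (a / `|a|)) *: x) +
      (1 - `|a| / s) *: ((c * s * (b / `|b|)) *: y).
    rewrite (_ : 1 - _ = `|b| / s); last first.
      by apply: (mulIf s0) => /=; rewrite mulrBl !divfK// mul1r /s addrC addKr.
    rewrite scalerDr !scalerA {1}(aE a) {1}(aE b).
    have rw (d n w : K) : n / s * (c * s * (d / w)) = c * (n * (d / w)).
      by rewrite [c * s]mulrC -(mulrA s) mulrA divfK// mulrCA.
    by rewrite !rw.
  have ub (d : K) z : U z -> C ((c * s * (d / `|d|)) *: z).
    move=> Uz; apply: Uz; rewrite normrM mulr_ile1 ?nE//.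
    by rewrite normrM (gtr0_norm sp) mulr_ile1// ltW.
  apply: convex_comb => //; [|exact: ub|exact: ub].
  by rewrite divr_ge0 ?(ltW sp)//= ler_pdivrMr// mul1r lerDl.
- have := @scale_continuous K G (0, 0) C.
  rewrite /= scaler0 => /(_ nC) [[P Q] [/= P0 Q0] PQ].
  have /nbhs_ballP[e /= e0 eP] := P0.
  have e20 : e / 2 != 0 by rewrite mulf_neq0 ?gt_eqF// invr_gt0.
  apply: filterS (nbhs0Z e20 Q0) => _ [z Qz <-] a a1.
  rewrite scalerA; apply: (PQ (_, z)); split => //=; apply: eP.
  rewrite -ball_normE /= sub0r normrN normrM (gtr0_norm (divr_gt0 e0 _))//.
  rewrite (le_lt_trans (ler_piMl _ a1)) ?divr_ge0 ?ltW//.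
  by rewrite ltr_pdivrMr// ltr_pMr// ltr1n.
Qed.

Lemma dsum_linear_continuous (G : tvsType K) (f : {linear dsum E -> G}) :
  (forall i, continuous (f \o @dsum_inj K I E i)) -> continuous f.
Proof.
move=> cf x A /=; rewrite -[f x]addr0 => fA.
have nV : nbhs 0 [set z | A (f x + z)].
  have := nbhsB (- f x) fA; rewrite addKr; apply: filterS => _ [z Az <-] /=.
  by rewrite addNKr.
have [U [cU nU UV]] := nbhs0_abs_convex nV.
apply/nbhs_dsumP; exists (f @^-1` U); last first.
  by move=> u /UV; rewrite /= -raddfD.
split; first split => /=.
- by rewrite raddf0; case: cU.
- move=> a b u v Uu Uv ab; rewrite linearD !linearZ /=.
  exact: cU.2.
- move=> i; have := cf i 0 U; rewrite /= !raddf0; exact.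
Qed.

End direct_sum_universal.

Variant scalar_field := RealScalars | ComplexScalars.

Definition scalars (R : realType) (F : scalar_field) : numFieldType :=
  match F with RealScalars => R | ComplexScalars => R[i]%C end.

Section modulus.
Context {R : realType} {F : scalar_field}.

(* The norm of [scalars R F] takes its values in [scalars R F]; [modulus] is
   its [R]-valued version, see [normr_modulus]. *)
Definition modulus : scalars R F -> R :=
  match F with
  | RealScalars => fun x : R => `|x|
  | ComplexScalars => fun x : R[i]%C => ComplexField.Normc.normc x
  end.

Definition scalar_of_real : R -> scalars R F :=
  match F with
  | RealScalars => fun r => r
  | ComplexScalars => fun r => r%:C%C
  end.

Lemma normr_modulus (x : scalars R F) : `|x| = scalar_of_real (modulus x).
Proof. by rewrite /modulus /scalar_of_real; case: F x. Qed.

Lemma modulus_ge0 (x : scalars R F) : 0 <= modulus x.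
Proof.
rewrite /modulus; case: F x => //= x.
by case: x => a b /=; rewrite sqrtr_ge0.
Qed.

Lemma modulusM (x y : scalars R F) : modulus (x * y) = modulus x * modulus y.
Proof.
rewrite /modulus; case: F x y => /= x y; first exact: normrM.
exact: ComplexField.Normc.normcM.
Qed.

Lemma modulus_eq0 (x : scalars R F) : modulus x = 0 -> x = 0.
Proof.
rewrite /modulus; case: F x => /= x; first by move/normr0P/eqP.
exact: ComplexField.Normc.eq0_normc.
Qed.

Lemma modulus0 : modulus (0 : scalars R F) = 0.
Proof.
rewrite /modulus; case: F => /=; first exact: normr0.
exact: ComplexField.Normc.normc0.
Qed.

Lemma scalar_of_realD (a b : R) :
  scalar_of_real (a + b) = scalar_of_real a + scalar_of_real b.
Proof. by rewrite /scalar_of_real; case: F => //=; rewrite rmorphD. Qed.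

Lemma scalar_of_realM (a b : R) :
  scalar_of_real (a * b) = scalar_of_real a * scalar_of_real b.
Proof. by rewrite /scalar_of_real; case: F => //=; rewrite rmorphM. Qed.

Lemma ler_scalar_of_real (a b : R) :
  (scalar_of_real a <= scalar_of_real b) = (a <= b).
Proof. by rewrite /scalar_of_real; case: F => //=; rewrite lecR. Qed.

Lemma modulusD (x y : scalars R F) : modulus (x + y) <= modulus x + modulus y.
Proof.
by rewrite -ler_scalar_of_real scalar_of_realD -!normr_modulus ler_normD.
Qed.

Lemma scalar_of_real_inj : injective scalar_of_real.
Proof. by rewrite /scalar_of_real; case: F => //= a b []. Qed.

End modulus.

Section lp_norm.
Context {R : realType}.
Local Notation mu := (@counting nat R).
Implicit Types (p : \bar R) (f g : nat -> R).
Local Open Scope ereal_scope.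

Lemma nat_measurable_fun f : measurable_fun [set: nat] f.
Proof. by []. Qed.

Lemma le_Lnorm_counting p f g : 1 <= p ->
  (forall n, (0 <= f n <= g n)%R) ->
  'N[mu]_p[EFin \o f] <= 'N[mu]_p[EFin \o g].
Proof.
move=> p1 fg.
have le_abs n : `|(f n)%:E| <= `|(g n)%:E|.
  have /andP[f0 fgn] := fg n.
  by rewrite !gee0_abs// lee_fin// (le_trans f0).
rewrite unlock; case: p p1 => [r r1|_|//].
  have r0 : (0 < r)%R by rewrite (lt_le_trans ltr01).
  have int0 (h : nat -> R) : 0 <= \int[mu]_x `|(EFin \o h) x| `^ r.
    by apply: integral_ge0 => n _; exact: poweR_ge0.
  apply: gt0_ler_poweR; rewrite ?in_itv/= ?leey ?andbT ?invr_ge0 ?(ltW r0)//;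
    [exact: int0|exact: int0|].
  apply: ge0_le_integral => //.
  move=> n _; rewrite lee_fin; apply: ge0_ler_powR; rewrite ?nnegrE ?(ltW r0)//.
  by move: (le_abs n); rewrite lee_fin.
case: ifPn => // _; apply: ess_sup_inf.le_ess_sup; apply: nearW => n /=.
exact: le_abs.
Qed.

Lemma Lnorm_counting_eq0 p f : 1 <= p -> 'N[mu]_p[EFin \o f] = 0 ->
  forall n, f n = 0%R.
Proof.
move=> p1 /Lnorm_eq0_eq0 fp0 n.
have [//||N [_ N0 fN]] := fp0; first exact: lt_le_trans p1.
apply: contrapT => fn0.
have Nn : N n by apply: fN => /= fE; apply: fn0; have := fE Logic.I => -[].
have : (mu [set n] <= mu N) by apply: le_measure; rewrite ?inE//= => _ ->.
rewrite N0 /counting/= asboolT; last exact: finite_set1.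
by rewrite fset_set1 finmap.cardfs1 leNgt lte01.
Qed.

Lemma Lnorm_countingZ p (a : R) f : 1 <= p -> (0 <= a)%R ->
  finite_norm mu p f ->
  'N[mu]_p[EFin \o (fun n => a * f n)%R] = a%:E * 'N[mu]_p[EFin \o f].
Proof.
move=> p1 a0 fp.
have fL : f \in Lfun mu p.
  by rewrite inE; apply/andP; split; rewrite inE.
have := LnormZ (Lfun_Sub p1 fL) a.
by rewrite ger0_norm.
Qed.

End lp_norm.

(* [ell F p1] is l_p for p < +oo, and c_0 (not l_oo) for p = +oo. Both carry the
   usual norm: the L_p norm for the counting measure on [nat] is the sum of
   [Lnorm_counting] for p < +oo, and the essential supremum, which is the
   supremum here, for p = +oo. *)
Definition summable_seq (R : realType) (F : scalar_field) (p : \bar R) :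
    {pred nat -> scalars R F} :=
  fun x => `[< finite_norm (@counting nat R) p (modulus \o x) /\
    (p = +oo%E -> x @ \oo --> (0 : (scalars R F)^o)) >].

Record ell (R : realType) (F : scalar_field) (p : \bar R) (p1 : (1 <= p)%E) :=
  Ell { ell_val : nat -> scalars R F; _ : ell_val \in @summable_seq R F p }.

Section ell_p.
Context (R : realType) (F : scalar_field) (p : \bar R) (p1 : (1 <= p)%E).
Local Notation K := (scalars R F).
Local Notation mu := (@counting nat R).
Local Notation summable_seq := (@summable_seq R F p).
Local Notation ell := (@ell R F p p1).

HB.instance Definition _ := [isSub for @ell_val R F p p1].
HB.instance Definition _ := [Choice of ell by <:].

Let modulusZ (a : K) (x : nat -> K) :
  modulus \o (a *: x) = (fun n => modulus a * (modulus \o x) n).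
Proof. by apply/funext => n /=; rewrite -modulusM. Qed.

Let LnormD (x y : nat -> K) :
  ('N[mu]_p[EFin \o (modulus \o (x + y)%R)] <=
   'N[mu]_p[EFin \o (modulus \o x)] + 'N[mu]_p[EFin \o (modulus \o y)])%E.
Proof.
apply: (@le_trans _ _ ('N[mu]_p[EFin \o ((modulus \o x) \+ (modulus \o y))%R])%E).
  by apply: le_Lnorm_counting => // n; rewrite modulus_ge0 modulusD.
exact: eminkowski.
Qed.

Let summable_seq_submod : submod_closed summable_seq.
Proof.
split.
  apply/asboolP; split; last by move=> _; exact: cvg_cst.
  rewrite (_ : _ \o _ = cst 0); last by apply/funext => n /=; rewrite modulus0.
  exact: (@finite_norm_cst0 _ _ _ mu p p1).
move=> a x y /asboolP[fx cx] /asboolP[fy cy]; apply/asboolP; split.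
  apply: le_lt_trans (LnormD _ _) _; apply: lte_add_pinfty => //.
  rewrite modulusZ Lnorm_countingZ ?modulus_ge0//.
  by rewrite lte_mul_pinfty ?lee_fin ?modulus_ge0.
move=> pE; rewrite (_ : 0 = a *: (0 : K^o) + 0); last by rewrite scaler0 addr0.
by apply: cvgD; [apply: cvgZr; exact: cx|exact: cy].
Qed.

HB.instance Definition _ :=
  GRing.isSubmodClosed.Build K (nat -> K) summable_seq summable_seq_submod.
HB.instance Definition _ := [SubChoice_isSubLmodule of ell by <:].

Definition ell_fun (x : ell) : nat -> K := ell_val x.
Coercion ell_fun : ell >-> Funclass.

Definition ell_norm (x : ell) : K :=
  scalar_of_real (fine 'N[mu]_p[EFin \o (modulus \o x)]%E).

Let ell_finite (x : ell) : ('N[mu]_p[EFin \o (modulus \o x)] \is a fin_num)%E.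
Proof.
rewrite ge0_fin_numE ?Lnorm_ge0//.
by case: x => x /= /asboolP[].
Qed.

Let ell_normD (x y : ell) : ell_norm (x + y) <= ell_norm x + ell_norm y.
Proof.
rewrite /ell_norm -scalar_of_realD ler_scalar_of_real -fineD//.
by rewrite fine_le// ?fin_numD ?ell_finite//; exact: LnormD.
Qed.

Let ell_normZ (a : K) (x : ell) : ell_norm (a *: x) = `|a| * ell_norm x.
Proof.
rewrite /ell_norm normr_modulus -scalar_of_realM; congr scalar_of_real.
rewrite [modulus \o _](modulusZ a x) Lnorm_countingZ ?modulus_ge0//.
  by rewrite fineM.
by case: x => x /= /asboolP[].
Qed.

Let ell_norm_eq0 (x : ell) : ell_norm x = 0 -> x = 0.
Proof.
move=> x0; apply: val_inj; apply/funext => n; apply: modulus_eq0.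
apply: (@Lnorm_counting_eq0 _ p (modulus \o x)) => //.
apply/eqP; rewrite -fine_eq0//; apply/eqP; apply: (@scalar_of_real_inj R F).
rewrite -[LHS]/(ell_norm x) x0.
by rewrite /scalar_of_real; case: (F).
Qed.

HB.instance Definition _ :=
  Lmodule_isNormed.Build K ell ell_normD ell_normZ ell_norm_eq0.

End ell_p.

Definition supp_set (K : numFieldType) (I : Type) (E : I -> tvsType K)
  (A : set (dsum E)) : set I := \bigcup_(x in A) supp x.

Definition coarse_limited (R : realType) (F : scalar_field) (p : \bar R)
    (p1 : (1 <= p)%E) (E : tvsType (scalars R F)) (A : set E) :=
  A !=set0 /\
  forall T : {linear E -> ell F p1}, continuous T -> compact (closure (T @` A)).

(* Main.v *)
From HB Require Import structures.
Require Import Defs.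
From mathcomp Require Import all_boot all_order all_algebra.
From mathcomp Require Import complex ring lra.
From mathcomp Require Import all_classical all_reals all_analysis.

Set Implicit Arguments.
Unset Strict Implicit.
Unset Printing Implicit Defensive.
Import Order.TTheory GRing.Theory Num.Theory.
Import numFieldNormedType.Exports.
Local Open Scope classical_set_scope.
Local Open Scope ring_scope.

(** A continuous linear image of a coarse [p]-limited set is coarse
    [p]-limited, which settles the passage to coordinate projections in both
    parts.

    For the product, a continuous linear map [T] into a normed space depends on
    finitely many coordinates only: some cylinder over a finite set [s] of
    indices is sent into the unit ball, so [T] is bounded on the subspace of
    points vanishing on [s], hence zero there
    ([prod_linear_finitely_supported]). Thus [T] is a finite sum of maps, each
    depending on one coordinate. A set of finite support in the direct sum
    gives the same kind of decomposition. In both cases [T @` A] lies in a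
    finite sum of relatively compact sets ([compact_closure_coord_sum]).

    It remains to see that a coarse [p]-limited subset [A] of the direct sum has
    finite support. Otherwise there are distinct indices [i_n] and points [x_n]
    of [A] with a nonzero coordinate at [i_n]. The spaces being Hausdorff and
    locally convex, there are continuous functionals [f_n] on [E (i_n)], scaled
    so that [f_n (x_n i_n)] times the [n]-th unit vector has norm [n]. The map
    [x |-> (f_n (x i_n))_n] is well defined, since the points of the direct sum
    have finite support, and continuous, since it is so on every summand; but
    it is unbounded on [A] ([coarse_limited_finite_supp]).

    The functionals come from the Hahn-Banach theorem. The real version,
    [hahn_banach], is obtained by applying Zorn's lemma to sublinear
    functionals rather than to partial linear ones: a minimal sublinear
    functional is linear. It is applied to the gauge of an absolutely convex
    neighborhood, and the complex case follows by taking the functional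
    [x |-> g x - i g (i x)] for a real linear [g]. *)

(** * The Hahn-Banach theorem over the reals *)

Section sublinear.
Context {R : realType} {V : lmodType R}.
Implicit Types (q p : V -> R) (x y : V).

(** Homogeneity is required as an inequality, which is easier to check; the
    reverse inequality comes from rescaling by [r^-1], see [sublinearZ]. *)
Definition sublinear q :=
  (forall x y, q (x + y) <= q x + q y) /\
  (forall (r : R) x, 0 < r -> q (r *: x) <= r * q x).

Lemma sublinearZ q (r : R) x : sublinear q -> 0 < r -> q (r *: x) = r * q x.
Proof.
move=> [_ qZ] r0; apply/le_anti; rewrite qZ//=.
have := qZ r^-1 (r *: x); rewrite scalerA mulVf ?gt_eqF// scale1r.
by rewrite invr_gt0 r0 => /(_ isT); rewrite mulrC ler_pdivlMr// mulrC.
Qed.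

Lemma sublinear0 q : sublinear q -> q 0 = 0.
Proof.
move=> qs; have := @sublinearZ q 2 0 qs.
by rewrite scaler0 ltr0n => /(_ isT); lra.
Qed.

Lemma sublinear_lower q x : sublinear q -> - q (- x) <= q x.
Proof.
by move=> qs; have := qs.1 x (- x); rewrite subrr (sublinear0 qs); lra.
Qed.

(** For sublinear [q], this is the largest sublinear functional [p] below [q]
    such that [p (- y) <= - q y]. *)
Definition tilt q y x :=
  inf [set q (x + t *: y) - t * q y | t in [set t : R | 0 <= t]].

Lemma tilt_le q y x (t : R) : sublinear q -> 0 <= t ->
  tilt q y x <= q (x + t *: y) - t * q y.
Proof.
move=> qs t0; apply: ge_inf; last by exists t.
exists (- q (- x)) => _ [s /= s0 <-].
have := qs.1 (x + s *: y) (- x); rewrite [x + _]addrC addrK.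
have [<-|s_neq0] := eqVneq 0 s.
  by rewrite !scale0r add0r mul0r (sublinear0 qs); lra.
have s_gt0 : 0 < s by rewrite lt_def eq_sym s_neq0.
by rewrite (sublinearZ _ qs s_gt0); lra.
Qed.

Lemma tilt_ge q y x (a : R) :
  (forall t : R, 0 <= t -> a <= q (x + t *: y) - t * q y) -> a <= tilt q y x.
Proof.
move=> h; apply: lb_le_inf; last first.
  by move=> _ [t /= t0 <-]; exact: h.
by exists (q (x + 0 *: y) - 0 * q y); exists 0 => /=.
Qed.

Lemma tilt_sublinear q y : sublinear q -> sublinear (tilt q y).
Proof.
move=> qs; split=> [x x'|r x r0].
  rewrite -lerBlDr; apply: tilt_ge => s s0; rewrite lerBlDr -lerBlDl.
  apply: tilt_ge => t t0; rewrite lerBlDl.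
  apply: (le_trans (tilt_le _ _ qs (addr_ge0 s0 t0))).
  have := qs.1 (x + s *: y) (x' + t *: y).
  by rewrite addrACA scalerDl; lra.
rewrite mulrC -ler_pdivrMr//; apply: tilt_ge => t t0; rewrite ler_pdivrMr//.
apply: (le_trans (tilt_le _ _ qs (mulr_ge0 (ltW r0) t0))).
by rewrite -scalerA -scalerDr (sublinearZ _ qs r0); lra.
Qed.

(** Minimality forces [tilt p y = p] for every [y]. The term [t = 1] of the
    infimum defining [tilt p y x] is therefore at least [p x]: this is the
    superadditivity [p x + p y <= p (x + y)]. *)
Lemma minimal_sublinear_is_linear p : sublinear p ->
  (forall p', sublinear p' -> (forall x, p' x <= p x) -> p' = p) -> linear p.
Proof.
move=> ps pmin.
have tp y : tilt p y = p.
  apply: pmin => [|x]; first exact: tilt_sublinear.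
  have := @tilt_le p y x 0 ps (lexx 0).
  by rewrite scale0r addr0 mul0r subr0.
have pD x y : p (x + y) = p x + p y.
  apply/le_anti; rewrite ps.1/=.
  have := @tilt_le p y x 1 ps ler01.
  by rewrite tp scale1r mul1r; lra.
have pN x : p (- x) = - p x.
  by have := pD x (- x); rewrite subrr (sublinear0 ps); lra.
move=> r x y; rewrite pD; congr (_ + _).
have [r0|r0|<-] := ltgtP 0 r; first by rewrite (sublinearZ _ ps r0).
  rewrite -[in LHS](opprK r) scaleNr pN (sublinearZ _ ps) ?oppr_gt0//.
  by rewrite mulNr opprK.
by rewrite !scale0r (sublinear0 ps).
Qed.

(** Zorn's lemma for the reversed pointwise order. The infimum of a chain is
    finite because every sublinear functional below [q] is at least
    [- q (- x)] at [x]; it is subadditive because the smaller of two members of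
    the chain can be used for both terms of the sum. *)
Lemma exists_minimal_sublinear q : sublinear q -> exists p,
  [/\ sublinear p, forall x, p x <= q x &
   forall p', sublinear p' -> (forall x, p' x <= p x) -> p' = p].
Proof.
move=> qs.
pose T := {p : V -> R | sublinear p /\ forall x, p x <= q x}.
pose Rel (s t : T) : bool := `[< forall x, sval t x <= sval s x >].
have lbT (s : T) x : - q (- x) <= sval s x.
  case: s => p /= [ps pq]; apply: le_trans (sublinear_lower x ps).
  by rewrite lerN2.
have [|||A Atot|[p [ps pq]] pmin] := @Zorn T Rel.
- by move=> s; apply/asboolP.
- move=> r s t /asboolP rs /asboolP st; apply/asboolP => x.
  exact: le_trans (st x) (rs x).
- move=> [p ps] [p' ps'] /asboolP st /asboolP ts; apply: eq_exist.
  by apply/funext => x; apply/le_anti/andP; split; [exact: ts|exact: st].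
- have [->|/set0P[s0 As0]] := eqVneq A set0.
    by exists (exist _ q (conj qs (fun x => lexx (q x)))).
  pose m x := inf [set sval s x | s in A].
  have mle s x : A s -> m x <= sval s x.
    move=> As; apply: ge_inf; last by exists s.
    by exists (- q (- x)) => _ [t _ <-].
  have mge x a : (forall s, A s -> a <= sval s x) -> a <= m x.
    move=> h; apply: lb_le_inf; first by exists (sval s0 x), s0.
    by move=> _ [s As <-]; exact: h.
  have ms : sublinear m.
    split=> [x y|r x r0].
      rewrite -lerBlDr; apply: (mge) => s As; rewrite lerBlDr -lerBlDl.
      apply: (mge) => t At; rewrite lerBlDl.
      have [/asboolP ts|/asboolP st] := Atot _ _ As At.
        apply: le_trans (mle _ _ At) _.
        apply: le_trans ((svalP t).1.1 x y) _.
        by apply: lerD.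
      apply: le_trans (mle _ _ As) _.
      apply: le_trans ((svalP s).1.1 x y) _.
      by apply: lerD.
    rewrite mulrC -ler_pdivrMr//; apply: (mge) => t At; rewrite ler_pdivrMr//.
    by apply: le_trans (mle _ _ At) _; rewrite mulrC (svalP t).1.2.
  have mq x : m x <= q x.
    by apply: le_trans (mle _ _ As0) _; exact: (svalP s0).2.
  exists (exist _ m (conj ms mq)) => s As; apply/asboolP => x /=.
  exact: mle.
exists p; split=> // p' p's p'p.
have p'q x : p' x <= q x by exact: le_trans (p'p x) (pq x).
have /(_ _)/(congr1 sval) := pmin (exist _ p' (conj p's p'q)).
by apply; apply/asboolP.
Qed.

(** A minimal sublinear functional is taken below [tilt q a] instead of [q]:
    this gives [f (- a) <= - q a], hence equality at [a]. *)
Theorem hahn_banach q (a : V) : sublinear q ->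
  exists f : {linear V -> R^o}, (forall x, f x <= q x) /\ f a = q a.
Proof.
move=> qs.
have [f [fs fq fmin]] := exists_minimal_sublinear (tilt_sublinear a qs).
have fl := minimal_sublinear_is_linear fs fmin.
have fq' x : f x <= q x.
  apply: le_trans (fq x) _; have := @tilt_le q a x 0 qs (lexx 0).
  by rewrite scale0r addr0 mul0r subr0.
pose fL := GRing.isLinear.Build R V R^o *:%R f fl.
pose g : {linear V -> R^o} := HB.pack f fL.
exists g; split => //; apply/le_anti; rewrite fq' /=.
have := fq (- a); have := @tilt_le q a (- a) 1 qs ler01.
rewrite scale1r addNr mul1r (sublinear0 qs).
by rewrite -[f (- a)]/(g (- a)) raddfN/=; lra.
Qed.

End sublinear.

(** * Gauges and separation from absolutely convex sets *)

Section gauge.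
Context {R : realType} {V : lmodType R} (U : set V).
Hypothesis U_abs_convex : abs_convex U.
Hypothesis U_absorbing : forall x, exists2 r : R, 0 < r & U (r^-1 *: x).

Definition gauge x := inf [set r : R | 0 < r /\ U (r^-1 *: x)].

Lemma gauge_le x (r : R) : 0 < r -> U (r^-1 *: x) -> gauge x <= r.
Proof. by move=> r0 Ux; apply: ge_inf => //; exists 0 => s [/ltW]. Qed.

Lemma gauge_ge x a : (forall r : R, 0 < r -> U (r^-1 *: x) -> a <= r) ->
  a <= gauge x.
Proof.
move=> h; apply: lb_le_inf => [|r [r0 Ur]]; last exact: h.
by have [r r0 Ur] := U_absorbing x; exists r.
Qed.

Lemma gauge_sublinear : sublinear gauge.
Proof.
split=> [x y|c x c0].
  (* (r + s)^-1 (x + y) is a convex combination of r^-1 x and s^-1 y *)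
  rewrite -lerBlDr; apply: gauge_ge => r r0 Ur; rewrite lerBlDr -lerBlDl.
  apply: gauge_ge => s s0 Us; rewrite lerBlDl.
  have rs0 : 0 < r + s by exact: addr_gt0.
  apply: gauge_le => //.
  have -> : (r + s)^-1 *: (x + y) =
      (r / (r + s)) *: (r^-1 *: x) + (s / (r + s)) *: (s^-1 *: y).
    rewrite !scalerA scalerDr ![_ / (r + s)]mulrC -!mulrA !mulfV ?gt_eqF//.
    by rewrite mulr1.
  apply: U_abs_convex.2 => //.
  by rewrite !gtr0_norm ?divr_gt0// -mulrDl mulfV ?gt_eqF.
rewrite mulrC -ler_pdivrMr//; apply: gauge_ge => r r0 Ur; rewrite ler_pdivrMr//.
apply: gauge_le; first exact: mulr_gt0.
by rewrite scalerA invfM -mulrA mulVf ?gt_eqF// mulr1.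
Qed.

Lemma gauge_le1 x : U x -> gauge x <= 1.
Proof. by move=> Ux; apply: gauge_le => //; rewrite invr1 scale1r. Qed.

Lemma gauge_ge1 x : ~ U x -> 1 <= gauge x.
Proof.
move=> Ux; apply: gauge_ge => r r0 Ur; rewrite leNgt; apply/negP => r1.
apply: Ux.
have := U_abs_convex.2 r 0 _ _ Ur U_abs_convex.1.
rewrite scaler0 addr0 scalerA mulfV ?gt_eqF// scale1r; apply.
by rewrite normr0 addr0 gtr0_norm// ltW.
Qed.

End gauge.

Section realification.
Context {R : realType} {F : scalar_field}.

Lemma scalar_of_real1 : scalar_of_real 1 = 1 :> scalars R F.
Proof. by rewrite /scalar_of_real; case: F. Qed.

Lemma modulus_scalar_of_real (r : R) :
  modulus (scalar_of_real r : scalars R F) = `|r|.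
Proof.
rewrite /modulus/scalar_of_real; case: F => //=.
by rewrite expr0n /= addr0 sqrtr_sqr.
Qed.

(** A copy of [V] on which only the real scalars act; it carries real
    functionals on [V] when [F] is [ComplexScalars]. *)
Definition realification (V : lmodType (scalars R F)) : Type := V.

Section instances.
Variable V : lmodType (scalars R F).
HB.instance Definition _ := GRing.Zmodule.on (realification V).

Let rscale (r : R) (x : realification V) : realification V :=
  (scalar_of_real r : scalars R F) *: (x : V).

Let rscaleA a b x : rscale a (rscale b x) = rscale (a * b) x.
Proof. by rewrite /rscale scalerA scalar_of_realM. Qed.
Let rscale1 : left_id 1 rscale.
Proof. by move=> x; rewrite /rscale scalar_of_real1; exact: (@scale1r _ V). Qed.
Let rscaleDr : right_distributive rscale +%R.
Proof. by move=> a x y; exact: (@scalerDr _ V). Qed.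
Let rscaleDl x : {morph rscale^~ x : a b / a + b}.
Proof.
by move=> a b; rewrite /rscale scalar_of_realD; exact: (@scalerDl _ V).
Qed.

HB.instance Definition _ := GRing.Zmodule_isLmodule.Build R (realification V)
  rscaleA rscale1 rscaleDr rscaleDl.
End instances.

End realification.

Section complexification.
Context {R : realType} (V : lmodType R[i]%C).
Notation VR := (@realification R ComplexScalars V).
Variable g : {linear VR -> R^o}.

(** The complex linear functional with real part [g]. *)
Definition complexify (x : V) : R[i]%C^o :=
  ((g x) +i* (- g (('i)%C *: x : V)))%C.

Let gD (x y : V) : g (x + y : V) = g x + g y.
Proof. exact: (raddfD g). Qed.

Let gZ (k : R[i]%C) (x : V) :
  g (k *: x : V) = complex.Re k * g x + complex.Im k * g (('i)%C *: x : V).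
Proof.
case: k => a b /=.
have -> : ((a +i* b)%C *: x : V) = a%:C%C *: x + b%:C%C *: (('i)%C *: x).
  rewrite scalerA -scalerDl; congr (_ *: _).
  by apply/eqP; rewrite eq_complex /=; apply/andP; split; apply/eqP; ring.
by rewrite gD; congr (_ + _); exact: (linearZZ g).
Qed.

Lemma complexify_linear : linear complexify.
Proof.
move=> k x y; rewrite /complexify scalerDr !gD scalerA mulrC -scalerA !(gZ k).
rewrite scalerA -expr2 sqr_i scaleN1r.
have gN z : g (- z : V) = - g z by exact: (raddfN g).
rewrite gN; case: k => a b.
by apply/eqP; rewrite eq_complex /=; apply/andP; split; apply/eqP; ring.
Qed.

Lemma modulus_complexify x :
  @modulus R ComplexScalars (complexify x) <= `|g x| + `|g (('i)%C *: x : V)|.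
Proof.
rewrite -[leRHS]ger0_norm ?addr_ge0// -sqrtr_sqr /= ler_wsqrtr//.
rewrite sqrrD !real_normK ?num_real// sqrrN lerD2r lerDl.
by rewrite mulrn_wge0// mulr_ge0.
Qed.

End complexification.

Section separation.
Context {R : realType}.

Lemma abs_convex_scale (K : numFieldType) (V : lmodType K) (U : set V)
    (k : K) x : abs_convex U -> `|k| <= 1 -> U x -> U (k *: x).
Proof.
move=> [U0 cU] k1 Ux; have := cU k 0 x 0 Ux U0.
by rewrite scaler0 normr0 !addr0; exact.
Qed.

(** The real functional given by [hahn_banach] equals the gauge, hence is at
    least [1], at [a], and it is bounded by [1] on [U], which is symmetric. The
    bound [2] allows for complexification: the real and the imaginary parts of
    the functional are both bounded by [1], as ['i%C *: x] stays in [U]. *)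
Lemma separating_functional {F : scalar_field} (V : lmodType (scalars R F))
    (U : set V) (a : V) : abs_convex U ->
  (forall x, exists2 r : R, 0 < r & U (scalar_of_real r^-1 *: x)) -> ~ U a ->
  exists f : {linear V -> (scalars R F)^o},
    (forall x, U x -> modulus (f x) <= 2) /\ f a != 0.
Proof.
move=> cU absU Ua.
have cUR : @abs_convex R (realification V) U.
  split=> [|s t x y Ux Uy st]; first exact: cU.1.
  apply: cU.2 => //; rewrite !normr_modulus !modulus_scalar_of_real.
  by rewrite -scalar_of_realD -(@scalar_of_real1 R F) ler_scalar_of_real.
have [g [gU ga]] :=
  hahn_banach (a : realification V) (gauge_sublinear cUR absU).
have g1 x : U x -> `|g x| <= 1.
  move=> Ux; rewrite ler_norml; apply/andP; split; last first.
    exact: le_trans (gU x) (gauge_le1 Ux).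
  rewrite lerNl; have <- : g (- x : V) = - g x by exact: (raddfN g).
  have UNx : U (- x).
    by rewrite -scaleN1r; apply: (abs_convex_scale cU) => //; rewrite normrN1.
  exact: le_trans (gU _) (gauge_le1 UNx).
have ga0 : g a != 0 by rewrite ga gt_eqF// (lt_le_trans ltr01)// gauge_ge1.
case: F V U a cU absU Ua cUR g gU ga g1 ga0 =>
  V U a cU absU Ua cUR g gU ga g1 ga0.
  pose fL := GRing.isLinear.Build R V R^o *:%R (g : V -> R^o)
    (fun k x y => linearP g k x y).
  pose f : {linear V -> R^o} := HB.pack (g : V -> R^o) fL.
  by exists f; split => // x /g1 gx; rewrite (le_trans gx)// ler1n.
pose fL := GRing.isLinear.Build R[i]%C V R[i]%C^o *:%R (complexify g)
  (complexify_linear g).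
pose f : {linear V -> R[i]%C^o} := HB.pack (complexify g) fL.
exists f; split => [x Ux|]; last first.
  by apply: contra_neq ga0 => -[].
apply: le_trans (modulus_complexify _ _) _.
rewrite -[2]/(1 + 1) lerD ?g1//.
apply: (abs_convex_scale cU) => //.
by rewrite normc_def /= expr0n add0r expr1n sqrtr1.
Qed.

End separation.

(** * Continuous functionals and relatively compact sets *)

Lemma bounded_near0_continuous (K : numFieldType) (E : tvsType K)
    (G : normedModType K) (f : {linear E -> G}) (M : K) :
  0 < M -> nbhs 0 [set x | `|f x| <= M] -> continuous f.
Proof.
move=> M0 fM z; apply/cvgrPdist_le => e e0.
have eM0 : e / M != 0 by rewrite gt_eqF// divr_gt0.
have := nbhsT z (nbhs0Z eM0 fM); apply: filterS => _ [_ [u /= fu <-] <-] /=.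
rewrite linearD linearZ/= opprD addNKr normrN normrZ gtr0_norm ?divr_gt0//.
by rewrite mulrAC ler_pdivrMr// ler_pM2l.
Qed.

Section functionals.
Context {R : realType} {F : scalar_field}.
Local Notation K := (scalars R F).

Lemma scalar_of_real0 : scalar_of_real 0 = 0 :> K.
Proof. by rewrite /scalar_of_real; case: F. Qed.

Lemma scalar_of_real_nat n : scalar_of_real n%:R = n%:R :> K.
Proof.
elim: n => [|n IHn]; first exact: scalar_of_real0.
by rewrite -natr1 scalar_of_realD IHn scalar_of_real1 natr1.
Qed.

Lemma pos_scalar_of_real (e : K) : 0 < e ->
  exists2 r : R, 0 < r & scalar_of_real r = e.
Proof.
move=> e0; exists (modulus e); last by rewrite -normr_modulus gtr0_norm.
rewrite lt_neqAle modulus_ge0 andbT eq_sym.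
apply: contraTneq e0 => /modulus_eq0 ->; by rewrite ltxx.
Qed.

Lemma nbhs0_absorbing (E : tvsType K) (U : set E) x : nbhs 0 U ->
  exists2 r : R, 0 < r & U (scalar_of_real r^-1 *: x).
Proof.
move=> U0; have := @scale_continuous K E (0, x) U.
rewrite /= scale0r => /(_ U0) [[P Q] [/= P0 /nbhs_singleton Qx] PQ].
have /nbhs_ballP[_ /pos_scalar_of_real[r r0 <-] rP] := P0.
have r20 : 0 < r / 2 by rewrite divr_gt0.
exists (r / 2)^-1; rewrite ?invr_gt0// invrK.
apply: (PQ (_, x)); split => //=; apply: rP.
rewrite -ball_normE/= sub0r normrN normr_modulus modulus_scalar_of_real.
rewrite gtr0_norm//.
rewrite lt_neqAle ler_scalar_of_real (inj_eq (@scalar_of_real_inj _ _)).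
by rewrite -lt_neqAle ltr_pdivrMr// ltr_pMr// ltr1n.
Qed.

(** Hausdorffness yields a neighborhood of [0] missing [a], and local convexity
    makes it absolutely convex. *)
Lemma exists_continuous_functional (E : tvsType K) (a : E) :
  hausdorff_space E -> a != 0 ->
  exists f : {linear E -> K^o}, continuous f /\ f a != 0.
Proof.
move=> hE a0.
have [V V0 Va] : exists2 V, nbhs (0 : E) V & ~ V a.
  apply: contrapT => noV; move/eqP: a0; apply; apply/esym/hE => A B A0 Ba.
  exists a; split; last exact: nbhs_singleton Ba.
  by apply: contrapT => Aa; apply: noV; exists A.
have [U [cU U0 UV]] := nbhs0_abs_convex V0.
have [f [fU fa]] : exists f : {linear E -> K^o},
    (forall x, U x -> modulus (f x) <= 2) /\ f a != 0.
  apply: separating_functional => // [x|/UV//]; exact: nbhs0_absorbing.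
exists f; split=> //; apply: (@bounded_near0_continuous _ _ _ _ 2) => //.
apply: filterS U0 => x /fU fx /=.
by rewrite normr_modulus -(@scalar_of_real_nat 2) ler_scalar_of_real.
Qed.

(** The norm takes its values in the possibly complex [K], so that the bound is
    stated with a natural number, and archimedeanity is used on the modulus. *)
Lemma compact_norm_le_nat (G : normedModType K) (C : set G) : compact C ->
  exists N : nat, forall x, C x -> `|x| <= N%:R.
Proof.
move=> /compact_near_coveringP/(_ nat \oo (fun n x => `|x| <= n%:R) _) h.
have [|N _ hN] := h; last by exists N; apply: hN => /=.
move=> x Cx.
pose m := Num.bound (modulus `|x|).
have xm : `|x| <= m%:R.
  rewrite -[leLHS]normr_id normr_modulus -scalar_of_real_nat ler_scalar_of_real.
  exact/ltW/archi_boundP/modulus_ge0.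
exists ([set y | `|x - y| < 1], [set n | (m.+1 <= n)%N]).
  split; last by exists m.+1.
  by apply/nbhs_ballP; exists 1 => //= y; rewrite -ball_normE.
move=> [y n] [/= xy mn].
apply: (@le_trans _ _ m.+1%:R); last by rewrite ler_nat.
rewrite -natr1 -[y](subKr x) (le_trans (ler_normB _ _))// lerD// ltW//.
Qed.

End functionals.

Section relatively_compact.
Context {K : numFieldType} {G : normedModType K}.

Lemma compact_closure_sub (B C : set G) : compact C -> B `<=` C ->
  compact (closure B).
Proof.
move=> cC BC; apply: (subclosed_compact (@closed_closure _ B) cC).
have /closure_id -> := compact_closed (@norm_hausdorff _ G) cC.
exact: closure_subset.
Qed.

(** A finite sum of compact sets is compact, being a continuous image of their
    product, and compact sets of a normed space are closed. *)
Lemma compact_closure_sum (X : Type) (A : set X) (J : eqType) (s : seq J)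
    (g : J -> X -> G) :
  (forall j, j \in s -> compact (closure (g j @` A))) ->
  compact (closure ((fun x => \sum_(j <- s) g j x) @` A)).
Proof.
elim: s => [|j s IHs] gc.
  apply: (compact_closure_sub (@compact_set1 _ (0 : G))) => _ [x _ <-].
  by rewrite big_nil.
have cs := IHs (fun k ks => gc k (@mem_behead _ (j :: s) k ks)).
have cj := gc j (mem_head j s).
pose S := (fun z : G * G => z.1 + z.2) @`
  (closure (g j @` A) `*` closure ((fun x => \sum_(k <- s) g k x) @` A)).
apply: (@compact_closure_sub _ S).
  apply: continuous_compact; last exact: compact_setX.
  by apply: continuous_subspaceT; exact: add_continuous.
move=> _ [x Ax <-]; rewrite big_cons.
exists (g j x, \sum_(k <- s) g k x) => //=.
by split; apply: subset_closure; exists x.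
Qed.

End relatively_compact.

(** * Unit vectors in the sequence spaces *)

Section ell_units.
Context {R : realType} {F : scalar_field} {p : \bar R} (p1 : (1 <= p)%E).
Local Notation K := (scalars R F).
Local Notation mu := (@counting nat R).
Local Notation ell := (@ell R F p p1).

Lemma finite_norm_indic1 k :
  finite_norm mu p (\1_[set k] : nat -> R).
Proof.
have mu1 : (mu [set k] < +oo)%E.
  rewrite /counting/= asboolT; last exact: finite_set1.
  by rewrite fset_set1 finmap.cardfs1 ltry.
rewrite /finite_norm unlock; case: p p1 => [r r1|_|//].
  have r0 : 0 < r by exact: lt_le_trans ltr01 r1.
  apply: poweR_lty; under eq_integral => x _.
    rewrite gee0_abs/= ?lee_fin// (_ : _ `^ r = \1_[set k] x).
      over.
    rewrite indicE; case: (_ \in _); first by rewrite powR1.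
    by rewrite powR0// gt_eqF.
  by rewrite integral_indic// setIT.
case: ifPn => // _; apply: (@le_lt_trans _ _ 1%E); last exact: ltry.
apply/ess_sup_inf.ess_supP; apply: nearW => x /=.
by rewrite lee_fin ger0_norm// indicE; case: (_ \in _).
Qed.

Lemma unit_seq_summable k :
  (fun n => (n == k)%:R : K) \in @summable_seq R F p.
Proof.
apply/asboolP; split.
  rewrite (_ : _ \o _ = \1_[set k]); first exact: finite_norm_indic1.
  apply/funext => n /=.
  rewrite indicE -scalar_of_real_nat modulus_scalar_of_real.
  rewrite normr_nat; congr (nat_of_bool _)%:R.
  by apply/eqP/idP => [->|/set_mem//]; rewrite inE.
move=> _; apply: cvg_near_cst; exists k.+1 => //= n kn.
by apply/eqP; rewrite gtn_eqF.
Qed.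

Definition ell_unit k : ell := Ell p1 (unit_seq_summable k).

Lemma ell_sumE (J : Type) (s : seq J) (x : J -> ell) n :
  (\sum_(j <- s) x j) n = \sum_(j <- s) x j n.
Proof. by elim/big_ind2 : _ => // _ y _ z <- <-. Qed.

Lemma finite_supp_summable (z : nat -> K) N :
  (forall n, (N <= n)%N -> z n = 0) -> z \in @summable_seq R F p.
Proof.
move=> zN; rewrite (_ : z = ell_val (\sum_(k < N) z k *: ell_unit k)).
  exact: valP.
apply/funext => n; rewrite -[RHS]/(ell_fun _ n) ell_sumE.
have [Nn|nN] := leqP N n.
  rewrite zN// big1// => k _; rewrite -[LHS]/(z k * (n == k)%:R).
  by rewrite gtn_eqF ?mulr0// (leq_trans _ Nn).
rewrite (bigD1 (Ordinal nN))//= big1 ?addr0 => [|k kn].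
  by rewrite -[RHS]/(z n * (n == n)%:R) eqxx mulr1.
rewrite -[LHS]/(z k * (n == k)%:R) (_ : (n == k) = false) ?mulr0//.
by apply: contra_neqF kn => /eqP nk; exact: val_inj.
Qed.

Lemma ell_unit_neq0 k : ell_unit k != 0.
Proof.
apply/eqP => /(congr1 (fun x : ell => x k)).
by move=> /eqP; rewrite /= /ell_fun/= eqxx oner_eq0.
Qed.

(** By monotonicity of the norm in the moduli of the coordinates. The unit
    vector stays in the statement, so that its norm need not be computed. *)
Lemma ell_norm_coord (x : ell) k : `|x k *: ell_unit k| <= `|x|.
Proof.
have fin (y : ell) : ('N[mu]_p[EFin \o (modulus \o y)] \is a fin_num)%E.
  rewrite ge0_fin_numE ?Lnorm_ge0//.
  by case: y => y /= /asboolP[].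
rewrite -[leLHS]/(ell_norm _) -[leRHS]/(ell_norm _).
rewrite /ell_norm ler_scalar_of_real.
apply: fine_le; rewrite ?fin//.
apply: le_Lnorm_counting => // n; rewrite modulus_ge0 andTb.
rewrite -[leLHS]/(modulus (x k * (n == k)%:R)) -[leRHS]/(modulus (x n)).
by have [->|_] := eqVneq n k; rewrite ?mulr1// mulr0 modulus0 modulus_ge0.
Qed.

End ell_units.

(** * Coordinates in products and direct sums *)

Section coordinates.
Context {K : numFieldType} {I : Type} (E : I -> tvsType K).
Local Notation PE := (prod_topology E).

(** Neighborhoods contain cylinders over finitely many points: the sets that
    contain such a cylinder form a filter converging to [x] coordinatewise,
    hence converging to [x]. *)
Lemma nbhs_prod_topology_cylinder (x : PE) (A : set PE) : nbhs x A ->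
  exists s : seq {classic I},
    forall y : PE, (forall i, i \in s -> y i = x i) -> A y.
Proof.
pose cyl : set_system PE := fun A =>
  exists s : seq {classic I},
    forall y : PE, (forall i, i \in s -> y i = x i) -> A y.
have cylF : Filter cyl.
  split; first by exists [::].
    move=> B C [s sB] [t tC]; exists (s ++ t) => y yx.
    by split; [apply: sB|apply: tC] => i ist; apply: yx;
      rewrite mem_cat ist ?orbT.
  by move=> B C BC [s sB]; exists s => y /sB/BC.
apply: (@prod_topology_cvg K I E cyl x cylF) => i B /nbhs_singleton Bx.
by exists [:: i] => y /(_ i (mem_head _ _)) /= ->.
Qed.

Definition prod_proj i (x : PE) : E i := x i.

Lemma prod_proj_linear i : linear (@prod_proj i).
Proof. by []. Qed.

HB.instance Definition _ i :=
  GRing.isLinear.Build K PE (E i) *:%R (@prod_proj i) (@prod_proj_linear i).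

Definition dsum_proj i (x : dsum E) : E i := x i.

Lemma dsum_proj_linear i : linear (@dsum_proj i).
Proof. by []. Qed.

HB.instance Definition _ i :=
  GRing.isLinear.Build K (dsum E) (E i) *:%R (@dsum_proj i)
    (@dsum_proj_linear i).

Lemma dsum_proj_continuous i : continuous (@dsum_proj i).
Proof.
apply: dsum_linear_continuous => j.
have [ij|ji] := pselect (j = i).
  subst j; rewrite (_ : _ \o _ = id); first by move=> x; exact: cvg_id.
  by apply/funext => a /=; exact: dsum_inj_in.
rewrite (_ : _ \o _ = cst 0); first exact: cst_continuous.
by apply/funext => a /=; exact: dsum_inj_out.
Qed.

Lemma dsum_val_continuous : continuous (\val : dsum E -> PE).
Proof.
move=> x; apply: prod_topology_cvg => [|i]; last exact: dsum_proj_continuous.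
by apply: fmap_filter; exact: (@nbhs_filter (dsum E)).
Qed.

Lemma sum_dsum_inj (s : seq {classic I}) (x : forall i, E i) i :
  uniq s -> i \in s -> (\sum_(j <- s) dsum_inj (x j) : dsum E) i = x i.
Proof.
move=> us si; rewrite -[LHS]/(dsum_proj i _) raddf_sum (bigD1_seq i)//=.
rewrite [X in X + _](dsum_inj_in (x i)) big1 ?addr0// => j /eqP ji.
exact: dsum_inj_out.
Qed.

Lemma dsum_decomposition (s : seq {classic I}) (x : dsum E) :
  uniq s -> (forall i, x i != 0 -> i \in s) -> x = \sum_(j <- s) dsum_inj (x j).
Proof.
move=> us xs; apply: dsumP => i.
have [si|sNi] := boolP (i \in s); first by rewrite sum_dsum_inj.
rewrite -[RHS]/(dsum_proj i _) raddf_sum big1_seq/=.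
  by apply/eqP; apply: contraNT sNi; exact: xs.
move=> j sj; apply: dsum_inj_out => ji.
by move: sNi; rewrite -ji sj.
Qed.

(** On the points vanishing on [s], the map [T] is bounded by [1]; these points
    form a subspace, so that [T] vanishes on it. *)
Lemma prod_linear_finitely_supported (G : normedModType K)
    (T : {linear PE -> G}) :
  continuous T -> exists2 s : seq {classic I}, uniq s &
    forall x : PE, T x = \sum_(j <- s) T (\val (dsum_inj (x j))).
Proof.
move=> cT.
have := cT 0 (ball 0 1); rewrite linear0.
move=> /(_ (nbhsx_ballx _ _ ltr01))/nbhs_prod_topology_cylinder[s0 s01].
pose s := undup s0; exists s; first exact: undup_uniq.
have T0 (x : PE) : (forall i, i \in s -> x i = 0) -> T x = 0.
  move=> xs; apply/eqP/negP => /negP Tx.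
  (* the rescaled point has an image of norm exactly 1, outside the open ball *)
  have : ball 0 1 (T (`|T x|^-1 *: x)).
    apply: s01 => i; rewrite -mem_undup => /xs xi.
    by rewrite prod_topologyZ xi scaler0.
  rewrite -ball_normE /= sub0r normrN linearZ/= normrZ normfV normr_id.
  by rewrite mulVf ?normr_eq0// ltxx.
move=> x; apply/eqP; rewrite -subr_eq0 -!linear_sum -linearB.
apply/eqP/T0 => i si.
rewrite -[LHS]/(x i - dsum_fun _ i) sum_dsum_inj ?subrr//; exact: undup_uniq.
Qed.

End coordinates.

(** * Coarse limited sets *)

Section coarse.
Context {R : realType} {F : scalar_field} {p : \bar R} (p1 : (1 <= p)%E).
Local Notation K := (scalars R F).
Local Notation ell := (@ell R F p p1).

Lemma coarse_limited_image (E G : tvsType K) (f : {linear E -> G}) (A : set E) :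
  continuous f -> coarse_limited p1 A -> coarse_limited p1 (f @` A).
Proof.
move=> cf [A0 hA]; split; first exact: image_nonempty.
move=> T cT; rewrite image_comp.
have := hA (T \o f); apply => x.
by apply: continuous_comp; [exact: cf|exact: cT].
Qed.

(** Common to products and direct sums: [x] gives the coordinates of the points
    of [A], and each summand factors through a single coordinate projection. *)
Lemma compact_closure_coord_sum (I : Type) (E : I -> tvsType K) (X : Type)
    (A : set X) (x : X -> forall i, E i) (s : seq {classic I})
    (T : {linear dsum E -> ell}) :
  continuous T ->
  (forall i, coarse_limited p1 ((x^~ i) @` A)) ->
  compact (closure ((fun a => \sum_(j <- s) T (dsum_inj (x a j))) @` A)).
Proof.
move=> cT hA; apply: (@compact_closure_sum _ _ X A {classic I}) => j _.
rewrite (_ : _ @` A = (T \o @dsum_inj K I E j) @` ((x^~ j) @` A)); last first.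
  by rewrite image_comp.
apply: (hA j).2 => a; apply: continuous_comp; last exact: cT.
exact: dsum_inj_continuous.
Qed.

Section infinite_support.
Context {I : Type} (E : I -> tvsType K) (i_ : nat -> I) (i_inj : injective i_).
Variable f : forall n, {linear E (i_ n) -> K^o}.
Hypothesis f_continuous : forall n, continuous (f n).

Lemma diag_summable (x : dsum E) :
  (fun n => f n (x (i_ n)) : K) \in @summable_seq R F p.
Proof.
have [N hN] : exists N, forall n, (N <= n)%N -> x (i_ n) = 0.
  have : finite_set (i_ @^-1` supp x).
    apply: finite_preimage; first by move=> ? ? _ _; exact: i_inj.
    by case: x => x /= /asboolP.
  move=> /finite_seqP[s sE]; exists (\max_(n <- s) n).+1 => n sn.
  apply: contrapT => /eqP xn.
  have : [set` s] n by rewrite -sE.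
  move=> /= ns; move: sn; rewrite ltnNge => /negP; apply.
  exact: (@leq_bigmax_seq _ s xpredT id).
by apply: (finite_supp_summable p1 (N := N)) => n /hN ->; rewrite linear0.
Qed.

Definition diag_map (x : dsum E) : ell := Ell p1 (diag_summable x).

Lemma diag_map_linear : linear diag_map.
Proof.
by move=> k x y; apply: val_inj; apply/funext => n; exact: linearP.
Qed.

HB.instance Definition _ :=
  GRing.isLinear.Build K (dsum E) ell *:%R diag_map diag_map_linear.

Lemma diag_map_inj n (a : E (i_ n)) :
  diag_map (dsum_inj a) = f n a *: ell_unit p1 n.
Proof.
apply: val_inj; apply/funext => m.
rewrite -[LHS]/(f m (dsum_inj a (i_ m))) -[RHS]/(f n a * (m == n)%:R).
have [->|mn] := eqVneq m n; first by rewrite dsum_inj_in mulr1.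
rewrite mulr0 dsum_inj_out ?linear0//.
by move=> /i_inj/esym/eqP; rewrite (negbTE mn).
Qed.

(** On the summand of index [i_ n] the map takes its values in the line of the
    [n]-th unit vector, and it vanishes on all the other summands. *)
Lemma diag_map_continuous : continuous diag_map.
Proof.
apply: dsum_linear_continuous => j.
have [[n nj]|jN] := pselect (exists n, i_ n = j).
  subst j; rewrite (_ : _ \o _ = (fun a => f n a *: ell_unit p1 n)).
    by move=> a; apply: cvgZl; exact: f_continuous.
  by apply/funext => a; exact: diag_map_inj.
rewrite (_ : _ \o _ = cst 0); first exact: cst_continuous.
apply/funext => a; apply: val_inj; apply/funext => m.
rewrite -[LHS]/(f m (dsum_inj a (i_ m))) dsum_inj_out ?linear0// => ji.
by apply: jN; exists m.
Qed.

End infinite_support.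

(** Otherwise a diagonal map sends points of [A] to sequences whose [n]-th
    coordinate alone has norm [n], contradicting boundedness. *)
Lemma coarse_limited_finite_supp (I : Type) (E : I -> tvsType K)
    (A : set (dsum E)) : (forall i, hausdorff_space (E i)) ->
  coarse_limited p1 A -> finite_set (supp_set A).
Proof.
move=> hE [_ hA]; apply: contrapT => /infiniteP/card_leP[i_].
pose i n : I := \val (i_ (to_setT n)).
have i_inj : injective i.
  move=> m n /val_inj mn.
  have /(congr1 \val) // : to_setT m = to_setT n by apply: inj mn; rewrite inE.
have iA n : exists x : dsum E, A x /\ x (i n) != 0.
  have : supp_set A (i n) by exact: set_valP.
  by move=> [x Ax xn]; exists x.
have H n : exists x : dsum E, exists f : {linear E (i n) -> K^o},
    [/\ A x, continuous f & `|f (x (i n)) *: ell_unit p1 n| = n%:R].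
  have [x [Ax xn]] := iA n.
  have [f [cf fx]] := exists_continuous_functional (hE (i n)) xn.
  (* the factor that makes the n-th coordinate of the image of norm n *)
  pose c : K := n%:R / (f (x (i n)) * `|ell_unit p1 n|).
  exists x, (c \*: f); split=> //.
    by move=> a; apply: cvgZr; exact: cf.
  rewrite [LHS](normrZ (c * f (x (i n)))) normrM normf_div normr_nat.
  rewrite normrM normr_id -mulrA divfK// mulf_neq0// normr_eq0//.
  exact: ell_unit_neq0.
pose x n := projT1 (cid (H n)).
pose f n := projT1 (cid (projT2 (cid (H n)))).
have fP n : [/\ A (x n), continuous (f n) &
    `|f n (x n (i n)) *: ell_unit p1 n| = n%:R].
  exact: (projT2 (cid (projT2 (cid (H n))))).
pose T : {linear dsum E -> ell} := diag_map i_inj f.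
have cT : continuous T by apply: diag_map_continuous => n; case: (fP n).
have [N hN] := compact_norm_le_nat (hA T cT).
have [Ax _ fx] := fP N.+1.
have : `|T (x N.+1)| <= N%:R.
  by apply: hN; apply: subset_closure; exists (x N.+1).
have := ell_norm_coord (T (x N.+1)) N.+1.
rewrite -[T _ _]/(f N.+1 (x N.+1 (i N.+1))) fx => /le_trans/[apply].
by rewrite ler_nat ltnn.
Qed.

End coarse.

Theorem proposition4p3 (R : realType) (F : scalar_field)
    (p : \bar R) (p1 : (1 <= p)%E)
    (I : Type) (I_nonempty : inhabited I)
    (E : I -> tvsType (scalars R F))
    (E_hausdorff : forall i, hausdorff_space (E i)) :
  (forall A : set (prod_topology E), A !=set0 ->
    coarse_limited p1 A <->
    forall i, coarse_limited p1 [set x i | x in A])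
  /\
  (forall A : set (dsum E), A !=set0 ->
    coarse_limited p1 A <->
    (forall i, coarse_limited p1 [set x i | x in A]) /\
    finite_set (supp_set A)).
Proof.
split=> A A0; split.
- move=> hA i.
  apply: (@coarse_limited_image _ _ _ p1 _ _ (@prod_proj _ I E i)) hA.
  exact: prod_topology_proj.
- move=> hA; split=> // T cT.
  have [s us Ts] := prod_linear_finitely_supported cT.
  rewrite (_ : T @` A =
      (fun x => \sum_(j <- s) (T \o \val) (dsum_inj (x j))) @` A).
    apply: (compact_closure_coord_sum (x := fun x => x)) => //.
    move=> x; apply: continuous_comp; last exact: cT.
    exact: dsum_val_continuous.
  by congr (_ @` _); apply/funext.
- move=> hA; split; last exact: coarse_limited_finite_supp hA.
  move=> i; apply: (@coarse_limited_image _ _ _ p1 _ _ (@dsum_proj _ I E i)) hA.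
  exact: dsum_proj_continuous.
- move=> [hA /(@finite_seqP {classic I})[s0 sE]]; split=> // T cT.
  pose s := undup s0.
  have Ts (x : dsum E) : A x -> T x = \sum_(j <- s) T (dsum_inj (x j)).
    move=> Ax; rewrite -linear_sum -dsum_decomposition ?undup_uniq// => i xi.
    apply: (@etrans _ _ _ _ (mem_undup s0 i)).
    by have : supp_set A i by [exists x]; rewrite sE.
  rewrite (_ : T @` A = (fun x => \sum_(j <- s) T (dsum_inj (x j))) @` A).
    exact: (compact_closure_coord_sum (x := fun x : dsum E => x)).
  by apply/seteqP; split=> _ [x Ax <-]; exists x; rewrite ?Ts.
Qed.
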